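(* Let $n>1$ and let $(\mu,\nu)$ be symmetrically suitable measures on $(\mathbf{S}^n,\mathbf{S}^n)$. Then the outer optimal map $t^+$ satisfies $$t^+\in C^{\frac{1}{4n-1}}_{loc}(S_1)\qquad\text{and}\qquad t^+\in C^{\frac{1}{4n-1}}_{loc}(S_2).$$
   Context: Setting. $n>1$ is an integer, $\mathbf S^n=\{x\in\mathbf R^{n+1}:|x|=1\}$ (the boundary of the unit ball), and $\mathcal H^n$ denotes $n$-dimensional Hausdorff measure on $\mathbf S^n$. Borel probability measures $\mu,\nu$ on $\mathbf S^n$ are called symmetrically suitable if there is $\epsilon>0$ with $\mu\le\epsilon^{-1}\mathcal H^n$, $\nu\ge\epsilon\mathcal H^n$, $\nu\le\epsilon^{-1}\mathcal H^n$, $\mu\ge\epsilon\mathcal H^n$ (as measures on $\mathbf S^n$). One considers the problem of minimizing $\int|x-y|^2\,d\gamma(x,y)$ over Borel probability measures $\gamma$ on $\mathbf R^{n+1}\times\mathbf R^{n+1}$ with marginals $\mu$ and $\nu$. By a theorem of Gangbo and McCann, for symmetrically suitable measures the minimizer $\gamma$ is unique and there exist: a convex (Brenier) potential $\psi$ on $\mathbf R^{n+1}$; a partition $\mathbf S^n=S_0\cup S_1\cup S_2$ (with $S_0$ and $S_0\cup S_2$ closed, $S_1$ open); a homeomorphism $t^+:\mathbf S^n\to\mathbf S^n$ and a map $t^-$ with $t^-|_{\overline{S_2}}$ a homeomorphism onto its image (and $t^-:=t^+$ outside $S_2$), such that $\operatorname{spt}\gamma\subset\{(x,t^+(x))\}\cup\{(x,t^-(x)):x\in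 S_2\}$, $\partial\psi(x)$ is the segment $[t^+(x),t^-(x)]$ for $x\in\mathbf S^n$, and - $x\in S_0$ iff $t^+(x)=t^-(x)$ and $x\cdot t^+(x)=0$ (degenerate set); - $x\in S_1$ iff $t^+(x)=t^-(x)$ and $x\cdot t^+(x)>0$; - $x\in S_2$ iff $t^+(x)\neq t^-(x)$, $x\cdot t^+(x)>0$ and $x\cdot t^-(x)<0$ (bivalent set). On $S_2$ one has $t^+(x)-t^-(x)=\lambda(x)x$ with $\lambda$ continuous and positive. For $A\subset\mathbf S^n$, $f\in C^\alpha_{loc}(A)$ means every point of $A$ has a neighbourhood $W$ such that $f$ is $\alpha$-Hölder continuous on $W\cap A$. *)

(* Defs.v *)
From mathcomp Require Import all_boot all_order all_algebra.
From mathcomp Require Import all_classical all_reals all_analysis.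
Import Order.TTheory GRing.Theory Num.Theory numFieldNormedType.Exports.
Set Implicit Arguments. Unset Strict Implicit. Unset Printing Implicit Defensive.
Local Open Scope classical_set_scope.
Local Open Scope ring_scope.

Definition dotE (R : realType) (k : nat) (u v : 'rV[R]_k) : R :=
  \sum_(i < k) u ord0 i * v ord0 i.

Definition enorm (R : realType) (k : nat) (u : 'rV[R]_k) : R :=
  Num.sqrt (dotE u u).

Definition sphere (R : realType) (n : nat) : set 'rV[R]_n.+1 :=
  [set x | enorm x = 1].
Arguments sphere : clear implicits.

Definition borelE (R : realType) (n : nat) :=
  g_sigma_algebraType (@open 'rV[R]_n.+1).

(* Volume of the unit ball of R^k: omega_0 = 1, omega_1 = 2,
   omega_(k+2) = 2 pi / (k+2) * omega_k  (= pi^(k/2) / Gamma(k/2 + 1)). *)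
Fixpoint omega (R : realType) (k : nat) : R :=
  match k with
  | 0 => 1
  | 1 => 2
  | k'.+2 => (2 * pi / k'.+2%:R) * omega R k'
  end.

(* Diameter of a set (Euclidean), as an extended real (-oo for the empty set). *)
Definition diamE (R : realType) (k : nat) (A : set 'rV[R]_k) : \bar R :=
  ereal_sup [set (enorm (x - y))%:E | x in A & y in A].

(* The size-delta approximating Hausdorff measure H^m_delta on R^k
   (countable covers by sets of diameter <= delta; empty sets contribute 0). *)
Definition hausdorff_delta (R : realType) (k m : nat) (delta : R)
    (A : set 'rV[R]_k) : \bar R :=
  ereal_inf [set (\sum_(i <oo) (omega R m * (fine (diamE (C i)) / 2) ^+ m)%:E)%E
            | C in [set C : nat -> set 'rV[R]_k |
                    (forall i, (diamE (C i) <= delta%:E)%E) /\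
                    A `<=` \bigcup_i C i]].

Arguments hausdorff_delta {R} k m delta A.

Definition hausdorff (R : realType) (k m : nat) (A : set 'rV[R]_k) : \bar R :=
  ereal_sup [set hausdorff_delta k m delta A | delta in [set d : R | 0 < d]].
Arguments hausdorff {R} k m A.

(* Borel probability measures on S^n, viewed as Borel probability measures on
   R^(n+1) concentrated on S^n, which are symmetrically suitable. *)
Definition symmetrically_suitable (R : realType) (n : nat)
    (mu nu : probability (borelE R n) R) : Prop :=
  mu (~` sphere R n) = 0%E /\ nu (~` sphere R n) = 0%E /\
  exists2 eps : R, 0 < eps &
    forall A : set (borelE R n), measurable A -> A `<=` sphere R n ->
      [/\ (mu A <= eps^-1%:E * hausdorff n.+1 n A)%E,
          (eps%:E * hausdorff n.+1 n A <= nu A)%E,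
          (nu A <= eps^-1%:E * hausdorff n.+1 n A)%E &
          (eps%:E * hausdorff n.+1 n A <= mu A)%E].

Definition is_coupling (R : realType) (n : nat) (mu nu : probability (borelE R n) R)
    (g : probability (borelE R n * borelE R n)%type R) : Prop :=
  forall A : set (borelE R n), measurable A ->
    g (A `*` setT) = mu A /\ g (setT `*` A) = nu A.

Definition quad_cost (R : realType) (n : nat)
    (g : probability (borelE R n * borelE R n)%type R) : \bar R :=
  (\int[g]_z (dotE ((z.1 : 'rV[R]_n.+1) - z.2) ((z.1 : 'rV[R]_n.+1) - z.2))%:E)%E.

Definition optimal_plan (R : realType) (n : nat) (mu nu : probability (borelE R n) R)
    (g : probability (borelE R n * borelE R n)%type R) : Prop :=
  is_coupling mu nu g /\
  forall g', is_coupling mu nu g' -> (quad_cost g <= quad_cost g')%E.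

Definition spt (R : realType) (n : nat)
    (g : probability (borelE R n * borelE R n)%type R) :
    set ('rV[R]_n.+1 * 'rV[R]_n.+1) :=
  [set z | forall U : set ('rV[R]_n.+1 * 'rV[R]_n.+1), open U -> U z -> (0 < g U)%E].

Definition convex_fun (R : realType) (k : nat) (psi : 'rV[R]_k -> R) : Prop :=
  forall x y (t : R), 0 <= t <= 1 ->
    psi (t *: x + (1 - t) *: y) <= t * psi x + (1 - t) * psi y.

Definition subdiff (R : realType) (k : nat) (psi : 'rV[R]_k -> R) (x : 'rV[R]_k) :
    set 'rV[R]_k :=
  [set p | forall z, psi x + dotE p (z - x) <= psi z].

Definition segment (R : realType) (k : nat) (a b : 'rV[R]_k) : set 'rV[R]_k :=
  [set (1 - t) *: a + t *: b | t in [set t : R | 0 <= t <= 1]].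

Definition homeo_onto_image (R : realType) (k : nat) (f : 'rV[R]_k -> 'rV[R]_k)
    (A : set 'rV[R]_k) : Prop :=
  {within A, continuous f} /\
  exists g : 'rV[R]_k -> 'rV[R]_k,
    {within f @` A, continuous g} /\ (forall x, A x -> g (f x) = x).

Definition holder_loc (R : realType) (k : nat) (alpha : R)
    (f : 'rV[R]_k -> 'rV[R]_k) (A : set 'rV[R]_k) : Prop :=
  forall a, A a -> exists2 W : set 'rV[R]_k, nbhs a W &
    exists C : R, forall x y, W x -> A x -> W y -> A y ->
      enorm (f x - f y) <= C * powR (enorm (x - y)) alpha.

(* Main.v *)
Require Import Defs.
From mathcomp Require Import all_boot all_order all_algebra.
From mathcomp Require Import all_classical all_reals all_analysis.
From mathcomp Require Import ring lra zify.
Import Order.TTheory GRing.Theory Num.Theory numFieldNormedType.Exports.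
Local Open Scope classical_set_scope.
Local Open Scope ring_scope.

(** Let [psi] be the potential, [y0], [y1] subgradients at [x0], [x1], and put
    [D = |y1 - y0|], [d = |x1 - x0|].  The supporting functions at [x0] and [x1]
    give [psi z - psi x0 >= max_i (dot yi (z - x0)) - d D].  The c-segment
    [yt = (1 - t) y0 + t y1 + h x0], with [h] chosen so that [yt] lies on the
    sphere, has [h >= t (1 - t) D^2 / 3], and
    [dot yt (z - x0) <= max_i (dot yi (z - x0)) - h/2 |z - x0|^2] on the sphere.
    Hence, for [rho = 8 sqrt (d / D)] and [eta = D^2 rho / 64], mass arriving in
    the [eta]-tube around the middle half of the c-segment must start in the
    [rho]-cap at [x0].  The tube contains about [D / eta] disjoint [eta]-caps,
    while the [rho]-cap is covered by [C (rho / eta)^n] of them.  All [eta]-caps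
    have comparable mu- and nu-mass, since Hausdorff measure is invariant under
    the reflections exchanging two points of the sphere.  So
    [D / eta <= C (rho / eta)^n], that is [D^(4n-1) <= C d]. *)

(** * Euclidean norm and spherical caps *)

Lemma dotEC {R : realType} {k} (u v : 'rV[R]_k) : dotE u v = dotE v u.
Proof. by apply: eq_bigr => i _; rewrite mulrC. Qed.

Lemma dotEDl {R : realType} {k} (u v w : 'rV[R]_k) :
  dotE (u + v) w = dotE u w + dotE v w.
Proof. by rewrite -big_split; apply: eq_bigr => i _; rewrite mxE mulrDl. Qed.

Lemma dotEZl {R : realType} {k} (a : R) (u w : 'rV[R]_k) :
  dotE (a *: u) w = a * dotE u w.
Proof. by rewrite mulr_sumr; apply: eq_bigr => i _; rewrite mxE mulrA. Qed.

Lemma dotENl {R : realType} {k} (u w : 'rV[R]_k) : dotE (- u) w = - dotE u w.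
Proof. by rewrite -scaleN1r dotEZl mulN1r. Qed.

Lemma dotEDr {R : realType} {k} (u v w : 'rV[R]_k) :
  dotE w (u + v) = dotE w u + dotE w v.
Proof. by rewrite dotEC dotEDl !(dotEC w). Qed.

Lemma dotEZr {R : realType} {k} (a : R) (u w : 'rV[R]_k) :
  dotE w (a *: u) = a * dotE w u.
Proof. by rewrite dotEC dotEZl dotEC. Qed.

Lemma dotENr {R : realType} {k} (u w : 'rV[R]_k) : dotE w (- u) = - dotE w u.
Proof. by rewrite dotEC dotENl dotEC. Qed.

Definition dotElin := (@dotEDl, @dotEDr, @dotENl, @dotENr, @dotEZl, @dotEZr).

Lemma dotE_ge0 {R : realType} {k} (u : 'rV[R]_k) : 0 <= dotE u u.
Proof. by apply: sumr_ge0 => i _; rewrite -expr2 sqr_ge0. Qed.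

Lemma enorm_ge0 {R : realType} {k} (u : 'rV[R]_k) : 0 <= enorm u.
Proof. exact: sqrtr_ge0. Qed.

Lemma sqr_enorm {R : realType} {k} (u : 'rV[R]_k) : enorm u ^+ 2 = dotE u u.
Proof. exact/sqr_sqrtr/dotE_ge0. Qed.

Lemma enorm_ler {R : realType} {k} (u : 'rV[R]_k) (r : R) :
  0 <= r -> (enorm u <= r) = (dotE u u <= r ^+ 2).
Proof. by move=> r0; rewrite -sqr_enorm ler_sqr // nnegrE ?enorm_ge0. Qed.

Lemma sqr_coord_le {R : realType} {k} (u : 'rV[R]_k) i : u ord0 i ^+ 2 <= dotE u u.
Proof.
rewrite /dotE (bigD1 i) //= -expr2 lerDl.
by apply: sumr_ge0 => j _; rewrite -expr2 sqr_ge0.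
Qed.

Lemma coord_le_enorm {R : realType} {k} (u : 'rV[R]_k) i : `|u ord0 i| <= enorm u.
Proof.
rewrite -ler_sqr ?nnegrE ?enorm_ge0 //.
by rewrite sqr_enorm real_normK ?num_real // sqr_coord_le.
Qed.

Lemma enorm_eq0 {R : realType} {k} (u : 'rV[R]_k) : (enorm u == 0) = (u == 0).
Proof.
apply/eqP/eqP => [u0|->]; last first.
  by rewrite /enorm /dotE big1 ?sqrtr0 // => i _; rewrite mxE mul0r.
apply/rowP => i; rewrite mxE; apply/eqP.
by rewrite -normr_eq0 eq_le normr_ge0 andbT -u0 coord_le_enorm.
Qed.

Lemma enorm_gt0 {R : realType} {k} (u : 'rV[R]_k) : (0 < enorm u) = (u != 0).
Proof. by rewrite lt_def enorm_ge0 enorm_eq0 andbT. Qed.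

Lemma dotE_le {R : realType} {k} (u v : 'rV[R]_k) : dotE u v <= enorm u * enorm v.
Proof.
have [->|u0] := eqVneq u 0.
  by rewrite {1}/dotE big1 ?mulr_ge0 ?enorm_ge0 // => i _; rewrite mxE mul0r.
have [->|v0] := eqVneq v 0.
  by rewrite {1}/dotE big1 ?mulr_ge0 ?enorm_ge0 // => i _; rewrite mxE mulr0.
have uv : 0 < enorm u * enorm v by rewrite mulr_gt0 // enorm_gt0.
have := dotE_ge0 (enorm v *: u - enorm u *: v).
rewrite !dotElin -!sqr_enorm (dotEC v u) => H.
rewrite -(ler_pM2l uv); lra.
Qed.

Lemma enormZ {R : realType} {k} (a : R) (u : 'rV[R]_k) : enorm (a *: u) = `|a| * enorm u.
Proof. by rewrite /enorm !dotElin mulrA -expr2 sqrtrM ?sqr_ge0 // sqrtr_sqr. Qed.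

Lemma enormN {R : realType} {k} (u : 'rV[R]_k) : enorm (- u) = enorm u.
Proof. by rewrite -scaleN1r enormZ normrN1 mul1r. Qed.

Lemma enormBC {R : realType} {k} (u v : 'rV[R]_k) : enorm (u - v) = enorm (v - u).
Proof. by rewrite -enormN opprB. Qed.

Lemma enormD {R : realType} {k} (u v : 'rV[R]_k) : enorm (u + v) <= enorm u + enorm v.
Proof.
rewrite enorm_ler ?addr_ge0 ?enorm_ge0 // !dotElin -!sqr_enorm (dotEC v u).
have := dotE_le u v; lra.
Qed.

Lemma enormB_trans {R : realType} {k} (v u w : 'rV[R]_k) :
  enorm (u - w) <= enorm (u - v) + enorm (v - w).
Proof. by have := enormD (u - v) (v - w); rewrite addrA subrK. Qed.

Lemma dotE_ge {R : realType} {k} (u v : 'rV[R]_k) : - (enorm u * enorm v) <= dotE u v.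
Proof. by have := dotE_le (- u) v; rewrite enormN dotENl; lra. Qed.

(** The norm [|u|] defining the topology is the maximum norm over coordinates. This bound and the
    next, whose factor [k.+1] is crude but sufficient, let Euclidean balls serve as
    neighbourhoods. *)
Lemma normr_le_enorm {R : realType} {k} (u : 'rV[R]_k.+1) : `|u| <= enorm u.
Proof.
rewrite /Num.norm /= mx_normrE; apply/bigmax_leP; split=> [|[i j] _ /=].
  exact: enorm_ge0.
by rewrite (ord1 i) coord_le_enorm.
Qed.

Lemma enorm_le_normr {R : realType} {k} (u : 'rV[R]_k.+1) : enorm u <= k.+1%:R * `|u|.
Proof.
rewrite enorm_ler ?mulr_ge0 //.
apply: (@le_trans _ _ (\sum_(i < k.+1) `|u| ^+ 2)).
  apply: ler_sum => i _; rewrite -expr2 -(@real_normK _ (u _ _)) ?num_real //.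
  rewrite ler_sqr ?nnegrE // [leRHS]/Num.norm /= mx_normrE.
  exact: (le_bigmax _ (fun ij : 'I_1 * 'I_k.+1 => `|u ij.1 ij.2|) (ord0, i)).
rewrite sumr_const card_ord -[leLHS]mulr_natl exprMn; apply: ler_wpM2r; rewrite ?sqr_ge0 //.
by rewrite expr2 ler_peMl // ler1n.
Qed.

Lemma open_eball {R : realType} {k} (a : 'rV[R]_k.+1) (r : R) :
  open [set x | enorm (x - a) < r].
Proof.
rewrite openE => x /= xr; apply/nbhs_ballP.
have e0 : 0 < (r - enorm (x - a)) / k.+1%:R by rewrite divr_gt0 // subr_gt0.
exists ((r - enorm (x - a)) / k.+1%:R) => // y.
rewrite -ball_normE /= ltr_pdivlMr // mulrC => xy.
apply: le_lt_trans (enormB_trans x _ _) _; rewrite -ltrBrDr.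
by apply: le_lt_trans xy; rewrite enormBC enorm_le_normr.
Qed.

Lemma nbhs_eball {R : realType} {k} (a : 'rV[R]_k.+1) (r : R) :
  0 < r -> nbhs a [set x | enorm (x - a) < r].
Proof.
move=> r0; apply: open_nbhs_nbhs; split; first exact: open_eball.
by rewrite /= subrr (eqP (_ : enorm 0 == 0)) // enorm_eq0.
Qed.

Lemma within_continuous_enorm {R : realType} {k} (f : 'rV[R]_k.+1 -> 'rV[R]_k.+1)
    (A : set 'rV[R]_k.+1) (a : 'rV[R]_k.+1) (e : R) :
  {within A, continuous f} -> A a -> 0 < e ->
  exists2 d, 0 < d & forall x, A x -> enorm (x - a) < d -> enorm (f x - f a) < e.
Proof.
move=> /subspace_continuousP cf Aa e0.
have /nbhs_ballP[d /= d0 dP] := cf a Aa _ (nbhs_eball (f a) e e0).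
exists d => // x Ax xa; apply: dP => //.
by rewrite -ball_normE /= distrC; apply: le_lt_trans xa; exact: normr_le_enorm.
Qed.

Definition cap {R : realType} {n} (y : 'rV[R]_n.+1) (r : R) : set 'rV[R]_n.+1 :=
  [set x | sphere R n x /\ enorm (x - y) < r].

Lemma closed_sphere {R : realType} {n} : closed (sphere R n).
Proof.
rewrite -[sphere R n]setCK; apply: open_closedC; rewrite openE => x /= x1.
have e0 : 0 < `|enorm x - 1| by rewrite normr_gt0 subr_eq0; apply/eqP.
apply: filterS (nbhs_eball x _ e0) => y /= xy y1.
suff : `|enorm x - 1| <= enorm (y - x) by rewrite leNgt xy.
have := enormB_trans x y 0; have := enormB_trans y x 0.
by rewrite !subr0 (enormBC x y) ler_norml y1 => ? ?; apply/andP; split; lra.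
Qed.

Lemma measurable_open {R : realType} {n} (A : set (borelE R n)) :
  open (A : set 'rV[R]_n.+1) -> measurable A.
Proof. by move=> oA; apply: sub_sigma_algebra. Qed.

Lemma measurable_sphere {R : realType} {n} : measurable (sphere R n : set (borelE R n)).
Proof.
rewrite -[sphere R n]setCK; apply: measurableC; apply: measurable_open.
by apply: closed_openC; apply: closed_sphere.
Qed.

Lemma measurable_cap {R : realType} {n} (y : 'rV[R]_n.+1) r :
  measurable (cap y r : set (borelE R n)).
Proof.
apply: measurableI; first exact: measurable_sphere.
by apply: measurable_open; apply: open_eball.
Qed.

(** * Comparing caps by reflections *)

(** Pushing a cover of [A] forward by [f] keeps every diameter, so each competitor for [A] gives one
    for the image at the same cost. *)
Lemma hausdorff_isometry {R : realType} {k} m (f : 'rV[R]_k -> 'rV[R]_k)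
    (A : set 'rV[R]_k) :
  (forall x y, enorm (f x - f y) = enorm (x - y)) ->
  (hausdorff k m (f @` A) <= hausdorff k m A)%E.
Proof.
move=> iso; apply: ge_ereal_sup => _ [d /= d0 <-].
apply: (@le_trans _ _ (hausdorff_delta k m d A)); last first.
  by apply: ereal_sup_ubound; exists d.
apply: ereal_inf_le_tmp => _ [C [dC AC] <-].
have diamf i : diamE (f @` C i) = diamE (C i).
  congr ereal_sup; apply/seteqP; split.
    by move=> _ [_ [x Cx <-]] [_ [y Cy <-] <-]; exists x => //; exists y; rewrite ?iso.
  move=> _ [x Cx] [y Cy <-].
  by exists (f x); [exists x|exists (f y); [exists y|rewrite iso]].
exists (fun i => f @` C i).
  split => [i|_ [x Ax <-]]; first by rewrite diamf.
  by have [i _ Cix] := AC _ Ax; exists i => //; exists x.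
by apply: eq_eseriesr => i _; rewrite diamf.
Qed.

(* At [w = 0] the division gives [0], so [householder 0] is the identity. *)
Definition householder {R : realType} {k} (w v : 'rV[R]_k) : 'rV[R]_k :=
  v - (2 * dotE v w / dotE w w) *: w.

Lemma dot_householder {R : realType} {k} (w v : 'rV[R]_k) :
  dotE (householder w v) w = - dotE v w.
Proof.
rewrite /householder !dotElin; have [->|w0] := eqVneq w 0.
  have d0 u : dotE u (0 : 'rV[R]_k) = 0 by rewrite -(scale0r u) dotEZr mul0r.
  by rewrite !d0 mulr0 subrr oppr0.
have ww : dotE w w != 0 by rewrite -sqr_enorm sqrf_eq0 enorm_eq0.
by rewrite divfK //; ring.
Qed.

Lemma householderK {R : realType} {k} (w : 'rV[R]_k) : involutive (householder w).
Proof.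
move=> v; rewrite {1}/householder dot_householder /householder.
by rewrite mulrN mulNr scaleNr opprK subrK.
Qed.

Lemma enorm_householder {R : realType} {k} (w v : 'rV[R]_k) : enorm (householder w v) = enorm v.
Proof.
rewrite /enorm; congr Num.sqrt.
rewrite [X in dotE _ X]/householder dotEDr dotENr dotEZr dot_householder.
by rewrite /householder !dotElin (dotEC w v); ring.
Qed.

Lemma householderB {R : realType} {k} (w x y : 'rV[R]_k) :
  householder w (x - y) = householder w x - householder w y.
Proof.
rewrite /householder !dotElin mulrBr mulrBl scalerBl; apply/rowP => i; rewrite !mxE; ring.
Qed.

(** Equal norms give [2 * dotE y (x - y) = - dotE (x - y) (x - y)], so the reflection coefficient is
    [-1]. *)
Lemma householder_swap {R : realType} {k} (x y : 'rV[R]_k) :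
  enorm x = enorm y -> householder (x - y) y = x.
Proof.
move=> xy; rewrite /householder.
have [->|nxy] := eqVneq x y; first by rewrite subrr scaler0 subr0.
have ww : dotE (x - y) (x - y) != 0.
  by rewrite -sqr_enorm sqrf_eq0 enorm_eq0 subr_eq0.
have -> : 2 * dotE y (x - y) / dotE (x - y) (x - y) = - 1.
  apply: (mulIf ww); rewrite divfK // !dotElin (dotEC y x).
  have : dotE x x = dotE y y by rewrite -!sqr_enorm xy.
  lra.
by rewrite scaleN1r opprK addrC subrK.
Qed.

(** The reflection exchanging [x] and [y] carries one cap onto the other, so their Hausdorff
    measures agree, and each density bound costs a factor [eps^-1]. The set functions are arbitrary
    so that the bound applies both to two different measures and to one measure with itself. *)
Lemma cap_le_cap {R : realType} {n} (mu nu : set (borelE R n) -> \bar R) (eps : R)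
    (x y : 'rV[R]_n.+1) (r : R) :
  0 < eps -> sphere R n x -> sphere R n y ->
  (forall A : set (borelE R n), measurable A -> A `<=` sphere R n ->
    (mu A <= eps^-1%:E * hausdorff n.+1 n A)%E /\
    (eps%:E * hausdorff n.+1 n A <= nu A)%E) ->
  (mu (cap x r) <= (eps^-1 ^+ 2)%:E * nu (cap y r))%E.
Proof.
move=> eps0 Sx Sy H.
have [Hx _] := H _ (measurable_cap x r) (@subIsetl _ _ _).
have [_ Hy] := H _ (measurable_cap y r) (@subIsetl _ _ _).
apply: le_trans Hx _.
have capE : cap x r = householder (x - y) @` cap y r.
  have fy : householder (x - y) y = x by apply: householder_swap; rewrite Sx Sy.
  apply/seteqP; split=> [z [Sz zr]|_ [z [Sz zr] <-]].
    exists (householder (x - y) z); last exact: householderK.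
    split; first by rewrite /sphere /= enorm_householder.
    have fx : householder (x - y) x = y by rewrite -[X in householder _ X]fy householderK.
    by rewrite /= -[X in _ - X]fx -householderB enorm_householder.
  split; first by rewrite /sphere /= enorm_householder.
  by rewrite /= -[X in _ - X]fy -householderB enorm_householder.
have Hxy : (hausdorff n.+1 n (cap x r) <= hausdorff n.+1 n (cap y r))%E.
  rewrite capE; apply: hausdorff_isometry => u v.
  by rewrite -householderB enorm_householder.
rewrite expr2 EFinM -muleA; apply: lee_wpmul2l; first by rewrite lee_fin invr_ge0 ltW.
apply: le_trans Hxy _; rewrite -[leLHS]mul1e -(mulVf (lt0r_neq0 eps0)) EFinM -muleA.
by apply: lee_wpmul2l; first by rewrite lee_fin invr_ge0 ltW.
Qed.

(** * Mass off the support *)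

Lemma rational_approx {R : realType} {n} (x : 'rV[R]_n.+1) (e : R) : 0 < e ->
  exists q : 'rV[rat]_n.+1, enorm (x - map_mx ratr q) < e.
Proof.
move=> e0; pose d := e / 2 / n.+1%:R.
have d0 : 0 < d by rewrite !divr_gt0.
have /choice[q qP] : forall i, exists q : rat, `|x ord0 i - ratr q| <= d.
  move=> i; have /rat_in_itvoo[q] : x ord0 i - d < x ord0 i + d by lra.
  by rewrite in_itv /= => /andP[? ?]; exists q; rewrite ler_norml; apply/andP; split; lra.
exists (\row_i q i); apply: le_lt_trans (enorm_le_normr _) _.
have : `|x - map_mx ratr (\row_i q i)| <= d.
  rewrite [leLHS]/Num.norm /= mx_normrE; apply/bigmax_leP; split=> [|[i j] _ /=].
    exact: ltW.
  by rewrite !mxE (ord1 i).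
rewrite -(ler_pM2l (ltr0Sn R n)) => /le_lt_trans; apply.
have -> : n.+1%:R * d = e / 2 by rewrite mulrC divfK // pnatr_eq0.
lra.
Qed.

(** A countable base of the product topology made of measurable rectangles: rational centres and a
    common radius of the form [1 / (k + 1)]. *)
Definition rat_box (R : realType) n (i : 'rV[rat]_n.+1 * 'rV[rat]_n.+1 * nat) :
    set (borelE R n * borelE R n) :=
  [set x | enorm ((x : 'rV[R]_n.+1) - map_mx ratr i.1.1) < i.2.+1%:R^-1] `*`
  [set x | enorm ((x : 'rV[R]_n.+1) - map_mx ratr i.1.2) < i.2.+1%:R^-1].

Lemma measurable_rat_box {R : realType} {n} i : measurable (rat_box R n i).
Proof. by apply: measurableX; apply: measurable_open; apply: open_eball. Qed.

Lemma open_rat_box {R : realType} {n} (U : set ('rV[R]_n.+1 * 'rV[R]_n.+1)) z :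
  open U -> U z -> exists2 i, rat_box R n i z & rat_box R n i `<=` U.
Proof.
case: z => x y; rewrite openE => /[apply] Uxy.
have [e e0 eU] : exists2 e : R, 0 < e & ball (x, y) e `<=` U by apply/nbhs_ballP.
have [k ke] : exists k : nat, k.+1%:R^-1 < e / 2 :> R.
  have [k _ kP] := near_infty_natSinv_lt (PosNum (divr_gt0 e0 (ltr0Sn R 1))).
  by exists k; apply: (kP k); rewrite /=.
have k0 : 0 < k.+1%:R^-1 :> R by rewrite invr_gt0.
have [p pP] := rational_approx x _ k0; have [q qP] := rational_approx y _ k0.
exists (p, q, k) => // -[u v] [].
change (enorm (u - map_mx ratr p) < k.+1%:R^-1 -> enorm (v - map_mx ratr q) < k.+1%:R^-1 -> U (u, v)).
move=> up vq; apply: eU; split => /=.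
  rewrite -ball_normE /=; apply: le_lt_trans (normr_le_enorm _) _.
  apply: le_lt_trans (enormB_trans (map_mx ratr p) _ _) _; rewrite (enormBC _ u).
  by rewrite [ltRHS]splitr; apply: ltrD; apply: lt_trans ke.
rewrite -ball_normE /=; apply: le_lt_trans (normr_le_enorm _) _.
apply: le_lt_trans (enormB_trans (map_mx ratr q) _ _) _; rewrite (enormBC _ v).
by rewrite [ltRHS]splitr; apply: ltrD; apply: lt_trans ke.
Qed.

(** The boxes satisfying [P], listed along [nat] through [unpickle] and padded with empty sets, so
    that results on countable unions apply. *)
Definition rat_boxes (R : realType) n (P : set (set (borelE R n * borelE R n))) m :
    set (borelE R n * borelE R n) :=
  if unpickle m is Some i then [set z | rat_box R n i z /\ P (rat_box R n i)] else set0.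

Lemma rat_boxesP {R : realType} {n} P m :
  rat_boxes R n P m = set0 \/ exists2 i, P (rat_box R n i) & rat_boxes R n P m = rat_box R n i.
Proof.
rewrite /rat_boxes; case: unpickle => [i|]; last by left.
have [Pi|nPi] := pselect (P (rat_box R n i)).
  by right; exists i => //; apply/seteqP; split=> z // [].
by left; apply/seteqP; split=> z // [].
Qed.

Lemma rat_boxesI {R : realType} {n} (P : set (set (borelE R n * borelE R n))) i :
  P (rat_box R n i) -> rat_box R n i `<=` \bigcup_m rat_boxes R n P m.
Proof. by move=> Pi z iz; exists (pickle i) => //; rewrite /rat_boxes pickleK. Qed.

(** The product sigma-algebra is built from rectangles, while openness refers to the product
    topology; the link is that [U] is the countable union of the rational boxes it contains. *)
Lemma measurable_open_prod {R : realType} {n} (U : set (borelE R n * borelE R n)) :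
  open (U : set ('rV[R]_n.+1 * 'rV[R]_n.+1)) -> measurable U.
Proof.
move=> oU; have -> : U = \bigcup_m rat_boxes R n [set V | V `<=` U] m.
  apply/seteqP; split=> z; last first.
    by move=> [m _]; have [->//|[i iU ->]] := rat_boxesP [set V | V `<=` U] m; apply: iU.
  by move=> /(open_rat_box _ _ oU)[i iz iU]; apply: rat_boxesI iz.
apply: bigcupT_measurable => m.
by have [->|[i iU ->]] := rat_boxesP [set V | V `<=` U] m; [|apply: measurable_rat_box].
Qed.

(** A point off the support has an open neighbourhood of measure zero, hence lies in a null rational
    box; there are only countably many such boxes. *)
Lemma null_off_spt {R : realType} {n} (g : probability (borelE R n * borelE R n)%type R)
    (A : set (borelE R n * borelE R n)) :
  measurable A -> A `&` spt g = set0 -> g A = 0%E.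
Proof.
move=> mA A0; apply: measure_negligible => //.
pose N V := g V = 0%E.
apply: (@negligibleS _ _ _ _ (\bigcup_m rat_boxes R n N m)); last first.
  apply: negligible_bigcup => m.
  have [->|[i gi ->]] := rat_boxesP N m; first exact: negligible_set0.
  by apply/negligibleP; [exact: measurable_rat_box|].
move=> z Az; have : ~ spt g z by move=> sz; have : (A `&` spt g) z by []; rewrite A0.
move=> /existsNP[U /not_implyP[oU /not_implyP[Uz /negP]]]; rewrite -leNgt => gU.
have [i iz iU] := open_rat_box _ _ oU Uz; apply: (rat_boxesI _ i) => //.
apply/eqP; rewrite -measure_le0; apply: le_trans gU; apply: le_measure => //; rewrite inE.
  exact: measurable_rat_box.
exact: measurable_open_prod.
Qed.

(** * Covering numbers of caps *)

(** On the sphere the other coordinates determine the square of coordinate [i], with an error of at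
    most [2 N s] here. As that coordinate has the same sign and size at least [1 / sqrt N] at both
    points, dividing by the sum of its two values controls the difference. *)
Lemma sphere_close {R : realType} {n} (x y : 'rV[R]_n.+1) i (s : R) :
  sphere R n x -> sphere R n y -> 0 <= s ->
  1 <= n.+1%:R * x ord0 i ^+ 2 -> 1 <= n.+1%:R * y ord0 i ^+ 2 ->
  0 <= x ord0 i * y ord0 i ->
  (forall j, j != i -> `|x ord0 j - y ord0 j| <= s) ->
  dotE (x - y) (x - y) <= (n.+1%:R ^+ 3 + n.+1%:R) * s ^+ 2.
Proof.
move=> Sx Sy s0 xi yi xyi xyj.
set N : R := n.+1%:R in xi yi *.
have N0 : 0 < N by rewrite ltr0Sn.
have sphE z : sphere R n z -> z ord0 i ^+ 2 = 1 - \sum_(j | j != i) z ord0 j ^+ 2.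
  move=> Sz; have : dotE z z = 1 by rewrite -sqr_enorm Sz expr1n.
  rewrite /dotE (bigD1 i) //= -expr2 => <-.
  by under [X in _ - X]eq_bigr do rewrite expr2; rewrite addrK.
have coord1 z j : sphere R n z -> `|z ord0 j| <= 1.
  by move=> Sz; rewrite -[leRHS]Sz coord_le_enorm.
have sumN (c : R) : 0 <= c -> \sum_(j < n.+1 | j != i) c <= N * c.
  move=> c0; apply: (@le_trans _ _ (\sum_(j < n.+1) c)).
    by rewrite [leRHS](bigID (fun j => j != i)) /= lerDl sumr_ge0.
  by rewrite sumr_const card_ord mulr_natl.
have dsq : `|x ord0 i ^+ 2 - y ord0 i ^+ 2| <= N * (2 * s).
  rewrite !sphE // opprD opprK addrACA subrr add0r addrC -sumrB.
  apply: le_trans (ler_norm_sum _ _ _) _; apply: le_trans (sumN _ _); last first.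
    by rewrite mulr_ge0.
  apply: ler_sum => j ji; rewrite distrC subr_sqr normrM [leRHS]mulrC ler_pM //.
    exact: xyj.
  apply: le_trans (ler_normD _ _) _.
  by have := coord1 _ j Sx; have := coord1 _ j Sy; lra.
set a := x ord0 i in xi xyi dsq *; set b := y ord0 i in yi xyi dsq *.
have ab : 1 <= N * (a * b).
  rewrite -(@ler_sqr _ 1) ?nnegrE ?(mulr_ge0 (ltW N0) xyi) // expr1n.
  have -> : (N * (a * b)) ^+ 2 = (N * a ^+ 2) * (N * b ^+ 2) by ring.
  by rewrite -[1]mulr1 ler_pM.
have apb : 4 <= N * (a + b) ^+ 2.
  have -> : N * (a + b) ^+ 2 = N * a ^+ 2 + N * b ^+ 2 + 2 * (N * (a * b)) by ring.
  lra.
have di : (a - b) ^+ 2 <= N ^+ 3 * s ^+ 2.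
  have : (a ^+ 2 - b ^+ 2) ^+ 2 <= (N * (2 * s)) ^+ 2.
    by rewrite -(real_normK (num_real (a ^+ 2 - b ^+ 2))) ler_sqr ?nnegrE // mulr_ge0 ?mulr_ge0 // ltW.
  rewrite subr_sqr exprMn => H.
  have := ler_wpM2l (ltW N0) H; rewrite mulrCA => H'.
  have : (a - b) ^+ 2 * 4 <= N * (N * (2 * s)) ^+ 2.
    by apply: le_trans H'; apply: ler_wpM2l => //; exact: sqr_ge0.
  have -> : N * (N * (2 * s)) ^+ 2 = (N ^+ 3 * s ^+ 2) * 4 by ring.
  by rewrite ler_pM2r.
rewrite /dotE (bigD1 i) //= -expr2 !mxE mulrDl; apply: lerD; first exact: di.
apply: le_trans (sumN _ (sqr_ge0 s)); apply: ler_sum => j ji.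
by rewrite -expr2 !mxE -(real_normK (num_real _)) ler_sqr ?nnegrE // xyj.
Qed.

(** One point of [D] is chosen in each fibre of [key] that meets [D]; this produces finite nets from
    finite labellings. *)
Lemma fin_representatives {T : pointedType} {K : finType} (key : T -> K) (D : set T) :
  exists s : seq T, [/\ (size s <= #|K|)%N, (forall x, x \in s -> D x) &
    forall x, D x -> exists2 y, y \in s & key y = key x].
Proof.
pose P k := exists x, D x /\ key x = k.
have /choice[f fP] : forall k, exists x, P k -> D x /\ key x = k.
  by move=> k; have [[x ?]|?] := pselect (P k); [exists x|exists point].
exists [seq f k | k <- enum K & `[< P k >]]; split.
- by rewrite size_map (leq_trans (size_subseq (filter_subseq _ _))) // cardE.
- by move=> _ /mapP[k + ->]; rewrite mem_filter => /andP[/asboolP/fP[]].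
- move=> x Dx; have Pk : P (key x) by exists x.
  exists (f (key x)); last by have [] := fP _ Pk.
  by apply: map_f; rewrite mem_filter mem_enum andbT; apply/asboolP.
Qed.

Lemma truncn_eq_dist {R : realType} (a b : R) : 0 <= a -> 0 <= b ->
  Num.truncn a = Num.truncn b -> `|a - b| <= 1.
Proof.
move=> a0 b0 ab; have := truncn_itv a0; have := truncn_itv b0.
rewrite ab -natr1 => /andP[? ?] /andP[? ?]; rewrite ler_norml; apply/andP; split; lra.
Qed.

(** Points are labelled by the index of their largest coordinate, its sign, and the grid cell of the
    remaining [n] coordinates; equal labels force distance below [eta]. Leaving out the largest
    coordinate is what makes the exponent [n] instead of [n + 1]. *)
Lemma cap_cover {R : realType} {n} (x0 : 'rV[R]_n.+1) (eta rho : R) :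
  0 < eta -> eta <= rho ->
  exists s : seq 'rV[R]_n.+1,
    [/\ (size s)%:R <= (2 * n.+1%:R) * (5 * n.+1%:R ^+ 2) ^+ n * (rho / eta) ^+ n,
        (forall y, y \in s -> sphere R n y) &
        forall x, cap x0 rho x -> exists2 y, y \in s & cap y eta x].
Proof.
move=> eta0 er.
set N : R := n.+1%:R.
have N1 : 1 <= N by rewrite ler1n.
have N0 : 0 < N by rewrite ltr0Sn.
(* This mesh makes the bound [(N ^+ 3 + N) * s ^+ 2] of [sphere_close] smaller than [eta ^+ 2]. *)
pose s := eta / (2 * N ^+ 2).
have s0 : 0 < s by rewrite divr_gt0 // mulr_gt0 // exprn_gt0.
(* Coordinates shifted by [rho] lie between [0] and [2 * rho] on the cap, so cell indices are at
   most [M] and [inord] does not collapse them. *)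
pose M := Num.truncn (2 * rho / s).
pose imax (x : 'rV[R]_n.+1) := [arg max_(i > ord0) `|x ord0 i|]%O.
pose coor (x : 'rV[R]_n.+1) j := (x ord0 j - x0 ord0 j + rho) / s.
pose key (x : 'rV[R]_n.+1) : 'I_n.+1 * bool * {ffun 'I_n -> 'I_M.+1} :=
  (imax x, 0 <= x ord0 (imax x),
   [ffun j => inord (Num.truncn (coor x (lift (imax x) j)))]).
have [t [st tD tP]] := fin_representatives key (cap x0 rho).
exists t; split => [|y /tD[]//|x Dx].
  rewrite -(ler_nat R) in st; apply: le_trans st _.
  rewrite !card_prod card_bool card_ffun !card_ord natrM natrM natrX -/N.
  rewrite -[leRHS]mulrA -exprMn [N * 2]mulrC; apply: ler_wpM2l; first by lra.
  apply: lerXn2r; rewrite ?nnegrE //.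
    rewrite mulr_ge0 ?divr_ge0 ?mulr_ge0 ?sqr_ge0 //; lra.
  have Ms : M%:R <= 2 * rho / s by rewrite truncn_le // divr_ge0 //; lra.
  (* The number of cells per axis is at most [4 N^2 rho / eta + 1]; since [rho / eta >= 1], the
     extra cell is absorbed and gives the constant [5]. *)
  have sE : 2 * rho / s = 4 * N ^+ 2 * (rho / eta) by rewrite /s; field; rewrite !lt0r_neq0.
  rewrite -natr1; have re : 1 <= rho / eta by rewrite ler_pdivlMr // mul1r.
  have : 1 <= N ^+ 2 * (rho / eta) by rewrite -[1]mulr1 ler_pM // exprn_ege1.
  rewrite sE in Ms; lra.
have [y ty kxy] := tP _ Dx; exists y => //.
have [Sy yr] := tD _ ty; have [Sx xr] := Dx; split => //.
case: kxy => iE sgE cE.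
(* The squares of the [N] coordinates sum to [1], so the largest is at least [1 / N]. *)
have imaxP z : sphere R n z -> 1 <= N * z ord0 (imax z) ^+ 2.
  move=> Sz; have <- : dotE z z = 1 by rewrite -sqr_enorm Sz expr1n.
  rewrite mulr_natl -[X in _ *+ X]card_ord -sumr_const; apply: ler_sum => j _.
  rewrite -expr2 -(real_normK (num_real (z ord0 j))) -(real_normK (num_real (z ord0 (imax z)))).
  rewrite ler_sqr ?nnegrE // /imax; case: arg_maxP => //= i _; exact.
have := sphere_close x y (imax x) s Sx Sy (ltW s0) (imaxP _ Sx).
rewrite -{1}iE => /(_ (imaxP _ Sy)) H.
have coorP z j : cap x0 rho z -> 0 <= coor z j <= 2 * rho / s.
  move=> [_ zr]; have := le_lt_trans (coord_le_enorm (z - x0) j) zr.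
  rewrite !mxE ltr_norml => /andP[? ?].
  apply/andP; split; first by apply: divr_ge0; [lra|exact: ltW].
  by rewrite ler_pM2r ?invr_gt0 //; lra.
have : dotE (x - y) (x - y) <= (N ^+ 3 + N) * s ^+ 2.
  apply: H.
    rewrite iE in sgE; case: (leP 0 (x ord0 (imax x))) sgE => xi sgE.
      by rewrite mulr_ge0.
    by rewrite mulr_le0 // ?(ltW xi) // ltW // ltNge sgE.
  move=> j ji; case: (unliftP (imax x) j) => [j' jE|jE]; last by rewrite jE eqxx in ji.
  rewrite iE in cE; move/ffunP/(_ j'): cE; rewrite !ffunE -jE => /(congr1 (@nat_of_ord _)).
  have tM z : cap x0 rho z -> (Num.truncn (coor z j) < M.+1)%N.
    by move=> /(coorP _ j)/andP[? ?]; rewrite ltnS le_truncn.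
  rewrite !inordK ?tM // => /truncn_eq_dist.
  have /andP[-> _] := coorP x j Dx; have /andP[-> _] := coorP y j (tD _ ty).
  move=> /(_ isT isT); rewrite /coor -mulrBl normrM (gtr0_norm (_ : 0 < s^-1)) ?invr_gt0 //.
  rewrite ler_pdivrMr // mul1r distrC; congr (`|_| <= _); ring.
rewrite -sqr_enorm => xy2.
rewrite -ltr_sqr ?nnegrE ?enorm_ge0 ?(ltW eta0) //; apply: le_lt_trans xy2 _.
have -> : (N ^+ 3 + N) * s ^+ 2 = eta ^+ 2 * ((N ^+ 2 + 1) / (4 * N ^+ 3)).
  by rewrite /s; field; rewrite lt0r_neq0.
rewrite gtr_pMr ?exprn_gt0 // ltr_pdivrMr ?mul1r ?mulr_gt0 ?exprn_gt0 //.
have : N ^+ 2 <= N ^+ 3 by rewrite ler_weXn2l.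
have : 1 <= N ^+ 2 by rewrite exprn_ege1.
lra.
Qed.

(** * The c-segment *)

(** The chord point has squared norm [1 - q] with [q = t (1 - t) |y1 - y0|^2] and inner product
    [b >= 0] with [x]. Reaching the sphere along [x] means [h^2 + 2 h b = q]; as [h] and [b] lie
    between [0] and [1], this gives [q <= 3 h]. *)
Lemma c_segment {R : realType} {n} (x y0 y1 : 'rV[R]_n.+1) (t : R) :
  sphere R n x -> sphere R n y0 -> sphere R n y1 ->
  0 <= dotE x y0 -> 0 <= dotE x y1 -> 0 <= t <= 1 ->
  exists2 h : R, t * (1 - t) * enorm (y1 - y0) ^+ 2 <= 3 * h &
    sphere R n ((1 - t) *: y0 + t *: y1 + h *: x).
Proof.
move=> Sx S0 S1 xy0 xy1 /andP[t0 t1].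
have xx : dotE x x = 1 by rewrite -sqr_enorm Sx expr1n.
have y00 : dotE y0 y0 = 1 by rewrite -sqr_enorm S0 expr1n.
have y11 : dotE y1 y1 = 1 by rewrite -sqr_enorm S1 expr1n.
have y01 : -1 <= dotE y0 y1 by have := dotE_ge y0 y1; rewrite S0 S1 mulr1.
have x0le : dotE x y0 <= 1 by have := dotE_le x y0; rewrite Sx S0 mulr1.
have x1le : dotE x y1 <= 1 by have := dotE_le x y1; rewrite Sx S1 mulr1.
have yle : dotE y0 y1 <= 1 by have := dotE_le y0 y1; rewrite S0 S1 mulr1.
pose b := (1 - t) * dotE x y0 + t * dotE x y1.
pose q := t * (1 - t) * enorm (y1 - y0) ^+ 2.
have qE : q = t * (1 - t) * (2 - 2 * dotE y0 y1).
  by rewrite /q sqr_enorm !dotElin y00 y11 (dotEC y1); ring.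
have s0 : 0 <= 1 - t by lra.
have b0 : 0 <= b by rewrite addr_ge0 ?mulr_ge0.
have b1 : b <= 1.
  have := ler_wpM2l s0 x0le; have := ler_wpM2l t0 x1le; rewrite /b; lra.
have q0 : 0 <= q by apply: mulr_ge0 (sqr_ge0 _); apply: mulr_ge0.
have tt : t * (1 - t) <= 1 / 4 by have := sqr_ge0 (t - 1 / 2); lra.
have q1 : q <= 1.
  rewrite qE; apply: (@le_trans _ _ (1 / 4 * 4)); last by lra.
  by apply: ler_pM; rewrite ?mulr_ge0 //; lra.
pose h := Num.sqrt (b ^+ 2 + q) - b.
have hq : h ^+ 2 + 2 * h * b = q.
  have : Num.sqrt (b ^+ 2 + q) ^+ 2 = b ^+ 2 + q by rewrite sqr_sqrtr // addr_ge0 ?sqr_ge0.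
  rewrite /h; set u := Num.sqrt _; move=> u2.
  have -> : (u - b) ^+ 2 + 2 * (u - b) * b = u ^+ 2 - b ^+ 2 by ring.
  by rewrite u2; ring.
have h0 : 0 <= h.
  rewrite subr_ge0 -{1}(ger0_norm b0) -sqrtr_sqr ler_wsqrtr //; lra.
have hb := mulr_ge0 h0 b0.
(* From [h^2 <= q <= 1], the last bound because [t (1 - t) <= 1/4] and the chord has length at most
   [2]. *)
have h1 : h <= 1.
  rewrite leNgt; apply/negP => h1.
  have : 1 < h * h by rewrite -[1]mulr1 ltr_pM.
  rewrite -expr2; lra.
exists h.
  rewrite -/q -hq; have := ler_wpM2l h0 h1; have := ler_wpM2l h0 b1; rewrite -expr2; lra.
suff e1 : enorm ((1 - t) *: y0 + t *: y1 + h *: x) ^+ 2 = 1.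
  by apply/eqP; rewrite -(@eqrXn2 _ 2) ?enorm_ge0 // e1 expr1n.
rewrite sqr_enorm !dotElin xx y00 y11 (dotEC y1 y0) (dotEC y0 x) (dotEC y1 x).
rewrite qE /b in hq; lra.
Qed.

(* Loeper's maximum principle: relative to [x], the supporting functions along
   the c-segment from [y0] to [y1] lie below the maximum of those at its ends
   by a multiple of [enorm (z - x) ^+ 2]. *)
Lemma c_segment_dot {R : realType} {n} (x y0 y1 z : 'rV[R]_n.+1) (t h : R) :
  sphere R n x -> sphere R n z ->
  dotE ((1 - t) *: y0 + t *: y1 + h *: x) (z - x) =
  (1 - t) * dotE y0 (z - x) + t * dotE y1 (z - x) - h / 2 * enorm (z - x) ^+ 2.
Proof.
move=> Sx Sz; rewrite !(dotEDl, dotEZl).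
have xx : dotE x x = 1 by rewrite -sqr_enorm Sx expr1n.
have zz : dotE z z = 1 by rewrite -sqr_enorm Sz expr1n.
have -> : dotE x (z - x) = - (enorm (z - x) ^+ 2 / 2).
  by rewrite sqr_enorm !dotElin xx zz (dotEC z x); lra.
by ring.
Qed.

(** If [r = |z - x0|] were at least [rho], comparing the lower bound for [psi z - psi x0] from [y0],
    [y1] with the upper bound from [y] would give [h/2 r^2 <= D d + |y - yt| r]. The left side is at
    least [D^2 r^2 / 32], and the choices of [rho] and of the tube radius keep each error term
    within half of that, one of them strictly. *)
Lemma contact_near {R : realType} {n} (psi : 'rV[R]_n.+1 -> R)
    (x0 x1 z y0 y1 y : 'rV[R]_n.+1) (t h rho : R) :
  sphere R n x0 -> sphere R n z ->
  subdiff psi x0 y0 -> subdiff psi x1 y1 -> subdiff psi z y ->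
  0 <= t <= 1 -> 3 * enorm (y1 - y0) ^+ 2 <= 48 * h ->
  0 < rho -> rho ^+ 2 * enorm (y1 - y0) = 64 * enorm (x1 - x0) ->
  enorm (y - ((1 - t) *: y0 + t *: y1 + h *: x0)) < enorm (y1 - y0) ^+ 2 * rho / 64 ->
  enorm (z - x0) < rho.
Proof.
move=> Sx Sz sub0 sub1 subz /andP[t0 t1] hD rho0 rhoE yeta.
rewrite ltNge; apply/negP => rr.
set D := enorm (y1 - y0) in hD rhoE yeta *.
set d := enorm (x1 - x0) in rhoE.
set r := enorm (z - x0) in rr.
set yt := (1 - t) *: y0 + t *: y1 + h *: x0 in yeta.
have r0 : 0 < r by apply: lt_le_trans rho0 rr.
have D0 : 0 <= D by exact: enorm_ge0.
have dD := dotE_le (y1 - y0) (x1 - x0); rewrite -/D -/d in dD.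
have Dd0 : 0 <= D * d by rewrite mulr_ge0 // enorm_ge0.
have yr := dotE_le (y - yt) (z - x0); rewrite -/r in yr.
have ytE := c_segment_dot x0 y0 y1 z t h Sx Sz; rewrite -/yt -/r in ytE.
have /= p0z := sub0 z; have /= p1z := sub1 z.
have /= p01 := sub0 x1; have /= pz0 := subz x0.
(* The supporting function at [x1] is rebased at [x0] using [psi x1 >= psi x0 + dotE y0 (x1 - x0)];
   the loss is [dotE (y1 - y0) (x1 - x0)]. *)
have a1 : psi x0 + dotE y1 (z - x0) - D * d <= psi z.
  by move: dD p1z p01; rewrite !dotElin; lra.
have a2 : (1 - t) * dotE y0 (z - x0) + t * dotE y1 (z - x0) - D * d <= psi z - psi x0.
  have s0 : 0 <= 1 - t by lra.
  have b1 : dotE y1 (z - x0) - D * d <= psi z - psi x0 by lra.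
  have b0 : dotE y0 (z - x0) <= psi z - psi x0 by lra.
  have := ler_wpM2l t0 b1; have := ler_wpM2l s0 b0.
  have := ler_wpM2r Dd0 t1; lra.
have a3 : psi z - psi x0 <= dotE yt (z - x0) + enorm (y - yt) * r.
  by move: pz0 yr; rewrite !dotElin; lra.
have e1 : enorm (y - yt) * r < D ^+ 2 * r ^+ 2 / 64.
  apply: (@lt_le_trans _ _ (D ^+ 2 * rho / 64 * r)); first by rewrite ltr_pM2r.
  have : D ^+ 2 * r * rho <= D ^+ 2 * r * r.
    by apply: ler_wpM2l => //; rewrite mulr_ge0 ?sqr_ge0 // ltW.
  lra.
have e2 : D * d <= D ^+ 2 * r ^+ 2 / 64.
  have -> : D * d = D ^+ 2 * rho ^+ 2 / 64.
    have -> : D ^+ 2 * rho ^+ 2 = D * (rho ^+ 2 * D) by ring.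
    by rewrite rhoE; lra.
  rewrite ler_pM2r ?invr_gt0 //; apply: ler_wpM2l; first exact: sqr_ge0.
  by rewrite ler_sqr ?nnegrE // ltW.
have e3 : D ^+ 2 * r ^+ 2 / 32 <= h / 2 * r ^+ 2.
  have := ler_wpM2r (sqr_ge0 r) hD; lra.
lra.
Qed.

Lemma dotE_sqr_le {R : realType} {k} (u v : 'rV[R]_k) :
  dotE u v ^+ 2 <= dotE u u * dotE v v.
Proof.
rewrite -!sqr_enorm -exprMn -(real_normK (num_real (dotE u v))).
rewrite ler_sqr ?nnegrE ?mulr_ge0 ?enorm_ge0 // ler_norml.
by rewrite dotE_ge dotE_le.
Qed.

(** The difference of the two points is a multiple of [y1 - y0] plus a multiple of [x], so it
    suffices that the part of [y1 - y0] orthogonal to [x] is not too short. The bound on [dotE x y0]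
    and [dotE x y1] keeps the chord away from the direction of [x]. *)
Lemma c_segment_separated {R : realType} {n} (x y0 y1 : 'rV[R]_n.+1) (kappa t t' h h' : R) :
  sphere R n x -> sphere R n y0 -> sphere R n y1 -> 0 < kappa <= 1 ->
  kappa <= dotE x y0 -> kappa <= dotE x y1 ->
  `|t - t'| * (kappa / 2 * enorm (y1 - y0)) <=
  enorm (((1 - t) *: y0 + t *: y1 + h *: x) - ((1 - t') *: y0 + t' *: y1 + h' *: x)).
Proof.
move=> Sx S0 S1 /andP[k0 k1] xy0 xy1.
set D := y1 - y0.
have -> : ((1 - t) *: y0 + t *: y1 + h *: x) - ((1 - t') *: y0 + t' *: y1 + h' *: x) =
    (t - t') *: D + (h - h') *: x.
  by apply/rowP => i; rewrite !mxE; ring.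
have xx : dotE x x = 1 by rewrite -sqr_enorm Sx expr1n.
have y00 : dotE y0 y0 = 1 by rewrite -sqr_enorm S0 expr1n.
have y11 : dotE y1 y1 = 1 by rewrite -sqr_enorm S1 expr1n.
set s := t - t'; set c := h - h'.
pose e := dotE D x; pose V := dotE D D - e ^+ 2.
(* [V] is the squared length of [D] projected orthogonally to [x]. Since [y0 + y1] is orthogonal to
   [D] and has component at least [2 * kappa] along [x], Cauchy-Schwarz against this projection
   bounds [e]. *)
have e2V : kappa ^+ 2 * e ^+ 2 <= V.
  have CS := dotE_sqr_le (y0 + y1) (D - e *: x).
  have E1 : dotE (D - e *: x) (D - e *: x) = V.
    by rewrite /V /e; move: (D) => u; rewrite !dotElin (dotEC x u) xx; ring.
  have E2 : dotE (y0 + y1) (D - e *: x) = - e * (dotE x y0 + dotE x y1).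
    by rewrite !dotElin y00 y11 (dotEC y1 y0) !(dotEC _ x); ring.
  have E3 : dotE (y0 + y1) (y0 + y1) <= 4.
    rewrite !dotElin y00 y11 (dotEC y1 y0).
    by have := dotE_le y0 y1; rewrite S0 S1; lra.
  have V0 : 0 <= V by rewrite -E1 dotE_ge0.
  rewrite E1 E2 exprMn sqrrN in CS.
  have := ler_wpM2r V0 E3 => H4.
  have : (2 * kappa) ^+ 2 <= (dotE x y0 + dotE x y1) ^+ 2.
    by rewrite ler_sqr ?nnegrE; lra.
  move=> /(ler_wpM2l (sqr_ge0 e)); lra.
have DV : kappa ^+ 2 * dotE D D <= 4 * V.
  have k2 : kappa ^+ 2 <= 1 by rewrite expr_le1 // ltW.
  have V0 : 0 <= V by apply: le_trans e2V; rewrite mulr_ge0 ?sqr_ge0.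
  have -> : dotE D D = V + e ^+ 2 by rewrite /V; ring.
  by have := ler_wpM2r V0 k2; lra.
rewrite -ler_sqr ?nnegrE ?enorm_ge0 ?mulr_ge0 ?enorm_ge0 //; last by lra.
rewrite !exprMn real_normK ?num_real // !sqr_enorm.
have -> : dotE (s *: D + c *: x) (s *: D + c *: x) = s ^+ 2 * V + (c + s * e) ^+ 2.
  by rewrite /V /e; move: (D) => u; rewrite !dotElin (dotEC x u) xx; ring.
apply: (@le_trans _ _ (s ^+ 2 * V)); last by rewrite lerDl sqr_ge0.
apply: ler_wpM2l; first exact: sqr_ge0.
lra.
Qed.

(** * Packing bound *)

Lemma measure_cover_le {d} {T : measurableType d} {R : realType}
    (mu : {measure set T -> \bar R}) {I : eqType} (F : I -> set T) (s : seq I)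
    (c : \bar R) (A : set T) :
  measurable A -> (forall i, measurable (F i)) -> (0 <= c)%E ->
  (forall i, i \in s -> (mu (F i) <= c)%E) ->
  (forall x, A x -> exists2 i, i \in s & F i x) ->
  (mu A <= (size s)%:R%:E * c)%E.
Proof.
move=> + mF c0; elim: s A => [|i s IH] A mA Fc AF.
  have -> : A = set0 by apply/seteqP; split=> x // /AF[].
  by rewrite measure0 mul0e.
rewrite (measureDI mu mA (mF i)) /= -natr1 EFinD ge0_muleDl ?lee_fin // mul1e.
apply: leeD.
  apply: IH => [|j js|x [Ax nFx]]; first exact: measurableD.
    by apply: Fc; rewrite inE js orbT.
  have [j] := AF _ Ax; rewrite inE => /orP[/eqP-> //|js Fjx].
  by exists j.
apply: le_trans (Fc i (mem_head _ _)); apply: le_measure; rewrite ?inE //.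
exact: measurableI.
Qed.

Lemma measure_packing_ge {d} {T : measurableType d} {R : realType}
    (mu : {measure set T -> \bar R}) (F : nat -> set T) (N : nat)
    (c : \bar R) (A : set T) :
  measurable A -> (forall i, measurable (F i)) -> (0 <= c)%E ->
  (forall i, (i < N)%N -> (c <= mu (F i))%E) ->
  (forall i, (i < N)%N -> F i `<=` A) ->
  (forall i j, (i < j < N)%N -> F i `&` F j = set0) ->
  (N%:R%:E * c <= mu A)%E.
Proof.
move=> + mF c0; elim: N A => [|N IH] A mA Fc FA dF; first by rewrite mul0e.
rewrite (measureDI mu mA (mF N)) /= -natr1 EFinD ge0_muleDl ?lee_fin // mul1e.
apply: leeD; last first.
  by apply: le_trans (Fc N (ltnSn _)) _; apply: le_measure; rewrite ?inE //;
    [exact: measurableI|move=> x Fx; split=> //; exact: FA Fx].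
apply: IH => [|i iN|i iN x Fx|i j /andP[ij jN]].
- exact: measurableD.
- by apply: Fc; exact: ltnW.
- split; first by apply: FA Fx; exact: ltnW.
  by move=> FNx; have : (F i `&` F N) x by []; rewrite dF // iN ltnSn.
- by apply: dF; rewrite ij ltnW.
Qed.

(** A pair with second entry in [B] has its first entry in [A], up to two null sets: pairs over the
    sphere outside [A], which miss the support, and pairs off the sphere, where [mu] vanishes. *)
Lemma coupling_le {R : realType} {n} (mu nu : probability (borelE R n) R)
    (g : probability (borelE R n * borelE R n)%type R) (A B : set (borelE R n)) :
  is_coupling mu nu g -> mu (~` sphere R n) = 0%E ->
  measurable A -> measurable B ->
  (forall x y, sphere R n x -> spt g (x, y) -> B y -> A x) ->
  (nu B <= mu A)%E.
Proof.
move=> cpl mu0 mA mB AB.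
have mS := @measurable_sphere R n; have mSC := measurableC mS.
have [_ <-] := cpl _ mB; have [<- _] := cpl _ mA.
pose E : set (borelE R n * borelE R n) := (sphere R n `\` A) `*` B.
pose S' : set (borelE R n * borelE R n) := ~` sphere R n `*` setT.
have gE : g E = 0%E.
  apply: null_off_spt; first by apply: measurableX => //; exact: measurableD.
  by apply/seteqP; split=> -[x y] //= [[[Sx nAx] By] sxy]; apply: nAx; apply: AB By.
have gS' : g S' = 0%E by have [-> _] := cpl _ mSC.
have mE : measurable E by apply: measurableX => //; exact: measurableD.
have mS' : measurable S' by exact: measurableX.
have mAT : measurable (A `*` setT : set (borelE R n * borelE R n)) by exact: measurableX.
rewrite -(measureU0 mAT mE gE) -(measureU0 _ mS' gS'); last exact: measurableU.
apply: le_measure; rewrite ?inE.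
- exact: measurableX.
- by apply: measurableU => //; exact: measurableU.
move=> [x y] [_ /= By].
have [Ax|nAx] := pselect (A x); first by left; left.
have [Sx|nSx] := pselect (sphere R n x); first by left; right.
by right.
Qed.

(** With [v] the [nu]-mass of one [eta]-cap, the [N] disjoint target caps carry at least [N v / e2],
    and this mass comes from the [rho]-cap, whose [mu]-mass is at most [c (rho / eta)^n e2 v].
    Dividing by [v] gives the bound. *)
Lemma packing_number_le {R : realType} {n} (mu nu : probability (borelE R n) R)
    (g : probability (borelE R n * borelE R n)%type R) :
  symmetrically_suitable mu nu -> is_coupling mu nu g ->
  exists2 C : R, 0 < C & forall (x : 'rV[R]_n.+1) (y : nat -> 'rV[R]_n.+1) (N : nat) (eta rho : R),
    sphere R n x -> 0 < eta -> eta <= rho ->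
    (forall k, (k < N)%N -> sphere R n (y k)) ->
    (forall k l, (k < l < N)%N -> 2 * eta <= enorm (y k - y l)) ->
    (forall z w k, (k < N)%N -> sphere R n z -> spt g (z, w) -> cap (y k) eta w -> cap x rho z) ->
    N%:R <= C * (rho / eta) ^+ n.
Proof.
move=> [muS [nuS [eps e0 H]]] cpl.
pose c : R := (2 * n.+1%:R) * (5 * n.+1%:R ^+ 2) ^+ n.
have c0 : 0 < c by rewrite mulr_gt0 ?exprn_gt0 ?mulr_gt0.
pose e2 := eps^-1 ^+ 2; have e20 : 0 < e2 by rewrite exprn_gt0 // invr_gt0.
exists (e2 ^+ 2 * c); first by rewrite mulr_gt0 // exprn_gt0.
move=> x y N eta rho Sx eta0 er Sy sep contact.
have munu u v r : sphere R n u -> sphere R n v ->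
    (mu (cap u r) <= e2%:E * nu (cap v r))%E.
  by move=> Su Sv; apply: cap_le_cap => // A mA /(H A mA)[].
have nunu u v r : sphere R n u -> sphere R n v ->
    (nu (cap u r) <= e2%:E * nu (cap v r))%E.
  by move=> Su Sv; apply: cap_le_cap => // A mA /(H A mA)[].
pose v := fine (nu (cap x eta)).
have vE : nu (cap x eta) = v%:E.
  by rewrite fineK // fin_num_measure //; exact: measurable_cap.
have v0 : 0 <= v by rewrite fine_ge0.
have cover (A : set (borelE R n)) r : measurable A -> eta <= r -> A `<=` cap x r ->
    (mu A <= (c * (r / eta) ^+ n * (e2 * v))%:E)%E.
  move=> mA er' Ar; have [s [ss sS sP]] := cap_cover x eta r eta0 er'.
  apply: (@le_trans _ _ ((size s)%:R%:E * (e2 * v)%:E)%E).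
    apply: (measure_cover_le mu (fun z => cap z eta : set (borelE R n))) => //.
    - by move=> i; exact: measurable_cap.
    - by rewrite lee_fin mulr_ge0 // ltW.
    - by move=> i /sS Si; rewrite EFinM -vE; exact: munu.
    - by move=> z /Ar /sP.
  by rewrite -EFinM lee_fin; apply: ler_wpM2r => //; rewrite mulr_ge0 // ltW.
have v_gt0 : 0 < v.
  (* If [v] vanished, covering the whole sphere by [eta]-caps would give it [mu]-mass zero. The
     radius [eta + 3] exceeds both [eta] and the diameter of the sphere. *)
  rewrite lt_def v0 andbT; apply/eqP => v00.
  have muS1 : mu (sphere R n) = 1%E.
    rewrite -[sphere R n]setCK probability_setC ?muS ?sube0 //.
    by apply: measurableC; exact: measurable_sphere.
  have : (mu (sphere R n) <= (c * ((eta + 3) / eta) ^+ n * (e2 * v))%:E)%E.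
    apply: cover; [exact: measurable_sphere|by rewrite lerDl|].
    move=> z Sz; split => //; apply: le_lt_trans (enormD z (- x)) _.
    by rewrite enormN Sz Sx; lra.
  by rewrite v00 mulr0 mulr0 muS1 lee_fin ler10.
pose T : set (borelE R n) := \bigcup_(k in `I_N) cap (y k) eta.
have mT : measurable T by apply: fin_bigcup_measurable => // k _; exact: measurable_cap.
have nuT : (nu T <= mu (cap x rho))%E.
  apply: (coupling_le _ _ _ _ _ cpl) => //; first exact: measurable_cap.
  by move=> z w Sz zw [k /= kN wk]; apply: contact zw wk.
have lower : (N%:R%:E * (v / e2)%:E <= nu T)%E.
  apply: (measure_packing_ge nu (fun k => cap (y k) eta : set (borelE R n))) => //.
  - by move=> i; exact: measurable_cap.
  - by rewrite lee_fin divr_ge0 // ltW.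
  - move=> i iN; rewrite -(@lee_pmul2l _ e2%:E) ?lte_fin // -EFinM mulrC divfK ?lt0r_neq0 //.
    by rewrite -vE; apply: nunu => //; exact: Sy.
  - by move=> i iN z zi; exists i.
  - move=> i j ijN; apply/seteqP; split=> z // -[[_ zi] [_ zj]].
    have := sep i j ijN; have := enormB_trans z (y i) (y j).
    by rewrite (enormBC (y i) z); lra.
have := le_trans lower (le_trans nuT (cover _ _ (measurable_cap x rho) er (@subset_refl _ _))).
rewrite -EFinM lee_fin => fin.
rewrite -(ler_pM2r (divr_gt0 v_gt0 e20)); apply: le_trans fin _.
by rewrite le_eqVlt; apply/orP; left; apply/eqP; field; rewrite lt0r_neq0.
Qed.

(** * Local Hoelder estimate *)

(** With [rho / eta = 64 / D^2] and about [8 kappa / (D rho)] caps along the c-segment, the packing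
    bound reads [D^(2n-1) <= L rho]. Squaring, multiplying by [D] and using [rho^2 D = 64 d] yields
    the exponent [4n - 1]. *)
Lemma image_distance {R : realType} {n} (hn : (0 < n)%N)
    (mu nu : probability (borelE R n) R)
    (g : probability (borelE R n * borelE R n)%type R) (psi : 'rV[R]_n.+1 -> R) (kappa : R) :
  symmetrically_suitable mu nu -> is_coupling mu nu g ->
  (forall x y, sphere R n x -> spt g (x, y) -> subdiff psi x y) ->
  0 < kappa <= 1 ->
  exists2 C : R, 0 <= C & forall x0 x1 y0 y1 : 'rV[R]_n.+1,
    sphere R n x0 -> sphere R n y0 -> sphere R n y1 ->
    subdiff psi x0 y0 -> subdiff psi x1 y1 ->
    kappa <= dotE x0 y0 -> kappa <= dotE x0 y1 -> x0 != x1 ->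
    enorm (y1 - y0) ^+ (4 * n - 1) <= C * enorm (x1 - x0).
Proof.
have n4 : (4 * n - 1 = ((2 * n - 1) * 2).+1)%N by lia.
have : (2 * n = (2 * n - 1).+1)%N by lia.
rewrite n4; move: (2 * n - 1)%N => m n2 {n4}.
move=> suit cpl sptsub kk; have /andP[k0 k1] := kk.
have [K K0 pack] := packing_number_le mu nu g suit cpl.
pose L := K * 64 ^+ n / (8 * kappa).
have L0 : 0 < L by rewrite divr_gt0 ?mulr_gt0 ?exprn_gt0.
have LE : L * (8 * kappa) = K * 64 ^+ n by rewrite divfK // lt0r_neq0 // mulr_gt0.
clearbody L; exists (64 * L ^+ 2); first by rewrite mulr_ge0 ?sqr_ge0.
move=> x0 x1 y0 y1 Sx S0 S1 sub0 sub1 xy0 xy1 x01.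
set D := enorm (y1 - y0); set d := enorm (x1 - x0).
have d0 : 0 < d by rewrite enorm_gt0 subr_eq0 eq_sym.
have := enorm_ge0 (y1 - y0); rewrite -/D le_eqVlt => /orP[/eqP <-|D0].
  rewrite expr0n; apply: mulr_ge0 (ltW d0); apply: mulr_ge0 (sqr_ge0 _).
  by [].
have D2 : D <= 2.
  by have := enormD y1 (- y0); rewrite enormN S0 S1 -/D; lra.
pose rho := 8 * Num.sqrt (d / D).
have rho0 : 0 < rho by rewrite mulr_gt0 // sqrtr_gt0 divr_gt0.
have rhoE : rho ^+ 2 * D = 64 * d.
  rewrite exprMn sqr_sqrtr ?divr_ge0 ?ltW //; field; exact: lt0r_neq0.
clearbody rho.
pose eta := D ^+ 2 * rho / 64.
have eta0 : 0 < eta by rewrite divr_gt0 // mulr_gt0 // exprn_gt0.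
have er : eta <= rho.
  rewrite /eta mulrAC -[leRHS]mul1r ler_pM2r // ler_pdivrMr // mul1r.
  by have := @lerXn2r _ 2 _ _ (ltW D0 : D \is Num.nneg) (_ : 2 \is Num.nneg) D2; rewrite nnegrE; lra.
(* By [c_segment_separated], this parameter step separates the points by at least [2 * eta]. Exactly
   [X] steps fill the range from [1/4] to [3/4]; counting [k = 0] as well gives [N] points, so
   [X <= N] even when [X < 1]. *)
pose tt k : R := 1 / 4 + k%:R * (4 * eta / (kappa * D)).
pose X := kappa * D / (8 * eta).
pose N := (Num.truncn X).+1.
have X0 : 0 <= X by rewrite divr_ge0 ?mulr_ge0 // ltW.
have kD0 : 0 < kappa * D by rewrite mulr_gt0.
have st0 : 0 <= 4 * eta / (kappa * D) by rewrite divr_ge0 ?mulr_ge0 // ltW.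
have ttP k : (k < N)%N -> 1 / 4 <= tt k <= 3 / 4.
  rewrite ltnS -(ler_nat R) => kX; have {}kX : k%:R <= X.
    by apply: le_trans kX _; rewrite truncn_le.
  have := ler_wpM2r st0 kX.
  have -> : X * (4 * eta / (kappa * D)) = 1 / 2 by rewrite /X; field; rewrite !lt0r_neq0.
  have : 0 <= k%:R * (4 * eta / (kappa * D)) by rewrite mulr_ge0.
  by rewrite /tt => ? ?; apply/andP; split; lra.
(* [choice] needs a total function of [k]; the value [0] beyond [N] is a dummy. *)
have /choice[hh hhP] : forall k, exists h : R, (k < N)%N ->
    3 * D ^+ 2 <= 48 * h /\ sphere R n ((1 - tt k) *: y0 + tt k *: y1 + h *: x0).
  move=> k; case: (ltnP k N) => kN; last by exists 0.
  have /andP[t1 t2] := ttP k kN.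
  have [|||h hD Sh] := c_segment x0 y0 y1 (tt k) Sx S0 S1.
  - by apply: le_trans xy0; exact: ltW.
  - by apply: le_trans xy1; exact: ltW.
  - by apply/andP; split; lra.
  exists h => _; split => //; rewrite -/D in hD.
  have t3 : 3 / 16 <= tt k * (1 - tt k).
    have : 0 <= (tt k - 1 / 4) * (3 / 4 - tt k) by rewrite mulr_ge0 //; lra.
    lra.
  by have := ler_wpM2r (sqr_ge0 D) t3; lra.
pose yy k := (1 - tt k) *: y0 + tt k *: y1 + hh k *: x0.
have NX : X <= N%:R by apply/ltW/truncnS_gt.
have : N%:R <= K * (rho / eta) ^+ n.
  apply: (pack x0 yy) => // [k /hhP[] //|k l /andP[kl lN]|z w k kN Sz zw [_ wk]].
  - apply: le_trans (c_segment_separated x0 y0 y1 kappa (tt k) (tt l) (hh k) (hh l) Sx S0 S1 kk xy0 xy1).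
    have -> : tt k - tt l = - ((l - k)%:R * (4 * eta / (kappa * D))).
      by rewrite /tt natrB ?(ltnW kl) //; ring.
    rewrite normrN ger0_norm ?(mulr_ge0 _ st0) // -/D.
    have -> : (l - k)%:R * (4 * eta / (kappa * D)) * (kappa / 2 * D) = (l - k)%:R * (2 * eta).
      by field; rewrite !lt0r_neq0.
    by apply: ler_peMl; [rewrite mulr_ge0 // ltW|rewrite ler1n subn_gt0].
  - split => //; have /andP[t1 t2] := ttP k kN.
    apply: (contact_near psi x0 x1 z y0 y1 w (tt k) (hh k) rho) => //.
    + exact: sptsub.
    + by apply/andP; split; lra.
    + by have [] := hhP k kN.
move=> /(le_trans NX).
have -> : rho / eta = 64 / D ^+ 2 by rewrite /eta; field; rewrite !lt0r_neq0.
have -> : X = 8 * kappa / (D * rho) by rewrite /X /eta; field; rewrite !lt0r_neq0.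
rewrite expr_div_n -exprM mulrA ler_pdivlMr ?exprn_gt0 // mulrAC ler_pdivrMr ?mulr_gt0 //.
rewrite n2 exprSr (mulrC D rho) !mulrA ler_pM2r // => Dm.
have {}Dm : D ^+ m <= L * rho.
  have kk0 : 0 < 8 * kappa by rewrite mulr_gt0.
  by rewrite -(ler_pM2l kk0) mulrA (mulrC _ L) LE.
have : (D ^+ m) ^+ 2 <= (L * rho) ^+ 2.
  by rewrite ler_sqr // nnegrE ?exprn_ge0 ?(ltW D0) // mulr_ge0 // ltW.
rewrite -exprM exprMn => Dm2; rewrite exprSr.
have := ler_wpM2r (ltW D0) Dm2; rewrite -[X in _ <= X]mulrA rhoE; lra.
Qed.

(** Continuity of [t] makes [dotE u (t v)] at least half of [dotE a (t a)] for all [u], [v] near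
    [a]. This includes the mixed products required by [image_distance], whose estimate then becomes
    a Hoelder bound on taking a root of order [4n - 1]. *)
Lemma holder_loc_visible {R : realType} {n} (hn : (0 < n)%N)
    (mu nu : probability (borelE R n) R)
    (g : probability (borelE R n * borelE R n)%type R)
    (psi : 'rV[R]_n.+1 -> R) (t : 'rV[R]_n.+1 -> 'rV[R]_n.+1) (A : set 'rV[R]_n.+1) :
  symmetrically_suitable mu nu -> is_coupling mu nu g ->
  (forall x y, sphere R n x -> spt g (x, y) -> subdiff psi x y) ->
  {within sphere R n, continuous t} -> t @` sphere R n `<=` sphere R n ->
  (forall x, sphere R n x -> subdiff psi x (t x)) ->
  A `<=` [set x | sphere R n x /\ 0 < dotE x (t x)] ->
  holder_loc ((4 * n - 1)%N%:R^-1) t A.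
Proof.
move=> suit cpl sptsub ct tS tsub AS a Aa; have [Sa a0] := AS _ Aa.
have St x : sphere R n x -> sphere R n (t x) by move=> Sx; apply: tS; exists x.
pose kappa := dotE a (t a) / 2.
have k0 : 0 < kappa by rewrite divr_gt0.
have k1 : kappa <= 1.
  by have := dotE_le a (t a); rewrite Sa (St _ Sa) /kappa; lra.
have [C C0 CP] := image_distance hn mu nu g psi kappa suit cpl sptsub (introT andP (conj k0 k1)).
have k20 : 0 < kappa / 2 by rewrite divr_gt0.
have [e e0 eP] := within_continuous_enorm t _ a _ ct Sa k20.
pose r := Num.min e (kappa / 2).
exists [set x | enorm (x - a) < r]; first by apply: nbhs_eball; rewrite lt_min e0 k20.
pose alpha : R := (4 * n - 1)%N%:R^-1.
have alpha0 : 0 <= alpha by rewrite invr_ge0.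
exists (C `^ alpha) => x y xr /AS[Sx _] yr /AS[Sy _]; rewrite -/alpha.
(* Since [dotE a (t a) = 2 * kappa], moving [a] to [u] and [t a] to [t v] may lose [kappa / 2]
   each. *)
have near u v : sphere R n u -> sphere R n v ->
    enorm (u - a) < r -> enorm (v - a) < r -> kappa <= dotE u (t v).
  rewrite !lt_min => Su Sv /andP[_ ur] /andP[vr _].
  have := eP _ Sv vr; have := dotE_ge (u - a) (t v); have := dotE_ge a (t v - t a).
  rewrite Sa (St _ Sv) mulr1 mul1r.
  have : dotE a (t a) = 2 * kappa by rewrite /kappa; lra.
  have : dotE u (t v) = dotE (u - a) (t v) + dotE a (t v - t a) + dotE a (t a).
    by rewrite !dotElin; ring.
  by move=> ->; lra.
have [->|xy] := eqVneq x y.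
  by rewrite subrr (eqP (_ : enorm 0 == 0)) ?enorm_eq0 // mulr_ge0 ?powR_ge0.
have H := CP x y (t x) (t y) Sx (St _ Sx) (St _ Sy) (tsub _ Sx) (tsub _ Sy)
  (near _ _ Sx Sx xr xr) (near _ _ Sx Sy xr yr) xy.
rewrite -powRM ?enorm_ge0 //.
rewrite (enormBC (t x)) (enormBC x).
set D := enorm (t y - t x) in H *.
have D0 : 0 <= D by exact: enorm_ge0.
have -> : D = (D ^+ (4 * n - 1)) `^ alpha.
  rewrite -powR_mulrn // -powRrM divff ?powRr1 // pnatr_eq0; lia.
by apply: ge0_ler_powR; rewrite ?nnegrE ?exprn_ge0 // mulr_ge0 ?enorm_ge0.
Qed.

Theorem theorem2p4 (R : realType) (n : nat) (hn : (1 < n)%N)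
  (mu nu : probability (borelE R n) R)
  (g : probability (borelE R n * borelE R n)%type R)
  (psi : 'rV[R]_n.+1 -> R)
  (S0 S1 S2 : set 'rV[R]_n.+1)
  (tp tm : 'rV[R]_n.+1 -> 'rV[R]_n.+1) :
  symmetrically_suitable mu nu ->
  optimal_plan mu nu g ->
  (* the Gangbo--McCann structure of the optimal plan *)
  convex_fun psi ->
  (* partition of S^n *)
  S0 `|` S1 `|` S2 = sphere R n ->
  S0 `&` S1 = set0 -> S0 `&` S2 = set0 -> S1 `&` S2 = set0 ->
  closed S0 -> closed (S0 `|` S2) ->
  (exists2 O : set 'rV[R]_n.+1, open O & S1 = O `&` sphere R n) ->
  (* t+ is a homeomorphism of S^n *)
  tp @` sphere R n = sphere R n ->
  {in sphere R n &, injective tp} ->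
  homeo_onto_image tp (sphere R n) ->
  (* t- : S^n -> S^n, homeomorphism of closure S2 onto its image, t- = t+ off S2 *)
  tm @` sphere R n `<=` sphere R n ->
  {in closure S2 &, injective tm} ->
  homeo_onto_image tm (closure S2) ->
  (forall x, sphere R n x -> ~ S2 x -> tm x = tp x) ->
  (* support of the optimal plan *)
  (forall x y, spt g (x, y) -> y = tp x \/ (S2 x /\ y = tm x)) ->
  (* subdifferential of the Brenier potential *)
  (forall x, sphere R n x -> subdiff psi x = segment (tp x) (tm x)) ->
  (* characterization of S0, S1, S2 *)
  (forall x, sphere R n x -> S0 x <-> tp x = tm x /\ dotE x (tp x) = 0) ->
  (forall x, sphere R n x -> S1 x <-> tp x = tm x /\ 0 < dotE x (tp x)) ->
  (forall x, sphere R n x ->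
     S2 x <-> [/\ tp x <> tm x, 0 < dotE x (tp x) & dotE x (tm x) < 0]) ->
  (exists lam : 'rV[R]_n.+1 -> R, {within S2, continuous lam} /\
     forall x, S2 x -> 0 < lam x /\ tp x - tm x = lam x *: x) ->
  holder_loc ((4 * n - 1)%N%:R^-1) tp S1 /\
  holder_loc ((4 * n - 1)%N%:R^-1) tp S2.
Proof.
move=> suit [cpl _] _ SU _ _ _ _ _ _ imtp _ [ctp _] _ _ _ _ sptP subP _ S1P S2P _.
(* Both ends of the segment are subgradients, so the graphs of [tp] and [tm], and with them the
   support of the plan, lie in the subdifferential. *)
have segl u v : segment (R:=R) u v u.
  by exists 0; rewrite /= ?lexx ?ler01 // subr0 scale1r scale0r addr0.
have segr u v : segment (R:=R) u v v.
  by exists 1; rewrite /= ?lexx ?ler01 // subrr scale1r scale0r add0r.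
have sptsub x y : sphere R n x -> spt g (x, y) -> subdiff psi x y.
  move=> Sx /sptP[->|[_ ->]]; rewrite subP //.
(* [S1] and [S2] are treated alike: on both, [dotE x (tp x)] is positive. *)
have hol A : A `<=` [set x | sphere R n x /\ 0 < dotE x (tp x)] ->
    holder_loc ((4 * n - 1)%N%:R^-1) tp A.
  apply: (holder_loc_visible (ltnW hn) _ _ _ _ _ _ suit cpl sptsub ctp).
    by rewrite imtp.
  by move=> x Sx; rewrite subP //; exact: segl.
split; apply: hol => x Sx.
  have Sph : sphere R n x by rewrite -SU; left; right.
  by have [] := (S1P _ Sph).1 Sx.
have Sph : sphere R n x by rewrite -SU; right.
by have [] := (S2P _ Sph).1 Sx.
Qed.
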